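(* Let $(X, \tau, <)$ be a GO-space whose underlying LOTS $(X, \lambda, <)$ has a $\sigma$-closed-discrete dense subset. Then the following are equivalent: (a) $(X, \tau)$ is monotonically metacompact; (b) $(X, \tau)$ is monotonically countably metacompact; (c) the set $R_\tau \cup L_\tau$ is $\sigma$-closed-discrete in $(X, \tau)$; (d) the set $R_\tau \cup L_\tau$ is $\sigma$-closed-discrete in $(X, \lambda)$.
   Context: A GO-space (generalized ordered space) is a triple $(X, \tau, <)$ where $<$ is a linear ordering of the set $X$ and $\tau$ is a Hausdorff topology on $X$ that has a base of convex subsets of $(X,<)$, possibly including some singletons. Let $\lambda$ be the usual open interval topology of $<$; then $\lambda \subseteq \tau$ and $(X, \lambda, <)$ is called the underlying LOTS (linearly ordered topological space) of the GO-space. Let $I_\tau := \{x \in X : \{x\} \in \tau\}$, $R_\tau := \{x \in X - I_\tau : [x, \rightarrow) \in \tau\}$, and $L_\tau := \{x \in X - I_\tau : (\leftarrow, x] \in \tau\}$. A subset of a space is closed-discrete if every point of the space has a neighborhood containing at most one point of the subset; it is $\sigma$-closed-discrete if it is a countable union of closed-discrete subsets. A ''$\sigma$-closed-discrete dense subset of $(X,\lambda)$'' is a subset that is both dense and $\sigma$-closed-discrete in $(X,\lambda)$. For two collections of sets $\mathcal{U}$ and $\mathcal{V}$, write $\mathcal{U} \prec \mathcal{V}$ if for each $U \in \mathcal{U}$ there is some $V \in \mathcal{V}$ with $U \subseteq V$. A space $X$ is monotonically metacompact (respectively, monotonically countably metacompact), in the sense of Popvassilev, if there is a function $r$ that associates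 with each open cover (respectively, each countable open cover) $\mathcal{U}$ of $X$ a point-finite collection $r(\mathcal{U})$ of open sets that covers $X$ and satisfies $r(\mathcal{U}) \prec \mathcal{U}$, in such a way that if $\mathcal{U}$ and $\mathcal{V}$ are open covers (respectively, countable open covers) of $X$ with $\mathcal{U} \prec \mathcal{V}$, then $r(\mathcal{U}) \prec r(\mathcal{V})$. (In the countable version, $r(\mathcal{U})$ is not required to be countable.) *)

(* Defs.v *)
From HB Require Import structures.
From mathcomp Require Import all_boot all_order interval all_classical topology.

Set Implicit Arguments.
Unset Strict Implicit.
Unset Printing Implicit Defensive.

Import Order.TTheory.
Local Open Scope classical_set_scope.
Local Open Scope order_scope.

Record topology_on (X : choiceType) := TopologyOn {
  open_sets : set (set X) ;
  open_setsT : open_sets setT ;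
  open_setsI : setI_closed open_sets ;
  open_sets_bigcup : forall C : set (set X),
    C `<=` open_sets -> open_sets (\bigcup_(A in C) A)
}.

(* The space (X, tau). An alias is needed because a GO-space carries two
   topologies on the same set, and because no MathComp structure joins
   [Topological] and [Order.Total] without forcing the order topology. *)
Definition space_of (X : choiceType) (tau : topology_on X) : Type := X.

Section SpaceOf.
Context (X : choiceType) (tau : topology_on X).

HB.instance Definition _ := Choice.on (space_of tau).

Let open_sets_bigU (I : Type) (f : I -> set (space_of tau)) :
  (forall i, open_sets tau (f i)) -> open_sets tau (\bigcup_i f i).
Proof.
move=> fo; rewrite -(bigcup_image setT f id).
by apply: open_sets_bigcup => _ [i _ <-].
Qed.

HB.instance Definition _ := isOpenTopological.Build (space_of tau)
  (open_setsT tau) (@open_setsI _ tau) open_sets_bigU.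

Lemma open_space_of (A : set X) : @open (space_of tau) A = open_sets tau A.
Proof. by []. Qed.

End SpaceOf.

Definition order_convex d (X : porderType d) (C : set X) : Prop :=
  forall x y z : X, C x -> C y -> x <= z -> z <= y -> C z.

(* (X, tau, <) is a GO-space; its underlying LOTS is [order_topology X]. *)
Definition GO_space d (X : orderType d) (tau : topology_on X) : Prop :=
  hausdorff_space (space_of tau) /\
  exists2 B : set (set (space_of tau)), basis B &
    forall C : set X, B C -> order_convex C.

Section GOPoints.
Context d (X : orderType d) (tau : topology_on X).

Definition go_I : set X := [set x | open_sets tau [set x]].

Definition go_R : set X := [set x | ~ go_I x /\ open_sets tau `[x, +oo[%classic].

Definition go_L : set X := [set x | ~ go_I x /\ open_sets tau `]-oo, x]%classic].

End GOPoints.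

Definition refines T (U V : set (set T)) : Prop :=
  forall A, U A -> exists2 B, V B & A `<=` B.

Definition point_finite T (U : set (set T)) : Prop :=
  forall x, finite_set [set A | U A /\ A x].

Section ClosedDiscrete.
Context (T : topologicalType).

Definition closed_discrete (A : set T) : Prop :=
  forall x : T, exists2 U, nbhs x U & is_subset1 (U `&` A).

Definition sigma_closed_discrete (A : set T) : Prop :=
  exists2 F : nat -> set T,
    (forall n, closed_discrete (F n)) & A = \bigcup_n F n.

End ClosedDiscrete.
Arguments sigma_closed_discrete : clear implicits.

Section MonotoneMetacompactness.
Context (T : topologicalType).

Definition open_cover (U : set (set T)) : Prop :=
  U `<=` open /\ cover U id = setT.

(* [r] is total; its values outside the class [P] of covers are irrelevant. *)
Definition monotone_metacompact_operator (P : set (set (set T)))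
    (r : set (set T) -> set (set T)) : Prop :=
  (forall U, P U ->
    [/\ open_cover (r U), point_finite (r U) & refines (r U) U]) /\
  (forall U V, P U -> P V -> refines U V -> refines (r U) (r V)).

Definition monotonically_metacompact : Prop :=
  exists r, monotone_metacompact_operator open_cover r.

Definition monotonically_countably_metacompact : Prop :=
  exists r, monotone_metacompact_operator
    [set U | open_cover U /\ countable U] r.

End MonotoneMetacompactness.
Arguments monotonically_metacompact : clear implicits.
Arguments monotonically_countably_metacompact : clear implicits.

(* Main.v *)
Require Import Defs.
From HB Require Import structures.
From mathcomp Require Import all_boot all_order interval all_classical topology.

(* R_tau and L_tau are treated alike, by orienting the order either way.

   (b) -> (c), (d): for x in R let G x be a member through x of the refinement of
   the clopen cover {(<-, x), [x, ->)}. If y 0 > y 1 > ... are points of R with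
   y 0 in every G (y i), apply the operator to the union W of the covers attached
   to the y i: only finitely many members of r(W) contain y 0, each lies in some
   [y i, ->), and yet each y i (i > 0) lies in one of them. Hence such sequences
   do not exist. If D is the union of the closed-discrete sets Dn n, this forces
   the set of those x in R for which some interval [x, e] with e in Dn n lies in
   G x to have a gap to the right of each point of R. A set whose points are each
   followed by a gap contains a point of D between any two of its points, and so
   splits into countably many sets that are closed-discrete for the order
   topology. This last step also gives (c) -> (d).

   (d) -> (a): let E n be increasing closed-discrete sets whose union contains D,
   R and L. The cells cut out by E n form point-finite open covers whose stars
   are a neighborhood base at each nonisolated point. Given an open cover U, keep
   the cells contained in members of U that are not inside such a cell of lower
   level, together with the singletons of the points in no such cell; these
   points are isolated. The stars at any point of a cell eventually lie in that
   cell, which bounds the levels of the kept cells through the point. *)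

Set Implicit Arguments.
Unset Strict Implicit.
Unset Printing Implicit Defensive.

Import Order.TTheory.
Local Open Scope classical_set_scope.

(** * Countable unions of closed-discrete sets *)

Section Generalities.
Context (T : topologicalType).
Implicit Types A B : set T.

Lemma open_locally A :
  (forall x, A x -> exists U, [/\ open U, U x & U `<=` A]) -> open A.
Proof.
move=> h; rewrite openE => x /h [U [oU Ux UA]].
by apply: filterS UA _; exact: open_nbhs_nbhs.
Qed.

Lemma sub_closed_discrete A B :
  A `<=` B -> closed_discrete B -> closed_discrete A.
Proof.
move=> AB cB x; have [U xU UB] := cB x; exists U => // y z [Uy Ay] [Uz Az].
by apply: UB; split => //; exact: AB.
Qed.

Lemma closed_discrete0 : closed_discrete (set0 : set T).
Proof. by move=> x; exists setT; [exact: filterT | move=> y z [_ []]]. Qed.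

Lemma sigma_closed_discrete_countable (I : countType) (F : I -> set T) :
  (forall i, closed_discrete (F i)) -> sigma_closed_discrete T (\bigcup_i F i).
Proof.
move=> cF; exists (fun n => if unpickle n is Some i then F i else set0).
  by move=> n; case: unpickle => [i|]; [exact: cF | exact: closed_discrete0].
apply/seteqP; split => [x [i _ Fix]|x [n _]].
  by exists (pickle i) => //; rewrite pickleK.
by case: unpickle => // i Fix; exists i.
Qed.

Lemma sigma_closed_discrete_bigcup (I : countType) (F : I -> set T) :
  (forall i, sigma_closed_discrete T (F i)) ->
  sigma_closed_discrete T (\bigcup_i F i).
Proof.
move=> /(_ _)/cid2 sF; pose G (p : I * nat) := sval (sF p.1) p.2.
have FE i : F i = \bigcup_n G (i, n) by rewrite /G /=; case: (sF i).
have -> : \bigcup_i F i = \bigcup_p G p.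
  apply/seteqP; split => [x [i _]|x [[i n] _ Gx]].
    by rewrite FE => -[n _ Gx]; exists (i, n).
  by exists i => //; rewrite FE; exists n.
apply: sigma_closed_discrete_countable => -[i n].
by rewrite /G /=; case: (sF i).
Qed.

End Generalities.

(** * Orientations of the order and isolating neighborhoods *)

Section Orientation.
Context d (X : orderType d).
Implicit Types (b : bool) (x y z : X).

(* The two orientations of the order, so that each one-sided argument is made
   only once: [b = true] is the given order, [b = false] its dual. *)
Definition ole b x y := (if b then x <= y else y <= x)%O.
Definition olt b x y := (if b then x < y else y < x)%O.

Lemma ole_refl b x : ole b x x.
Proof. by case: b => /=. Qed.

Lemma oltW b x y : olt b x y -> ole b x y.
Proof. by case: b => /ltW. Qed.

Lemma ole_trans b x y z : ole b x y -> ole b y z -> ole b x z.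
Proof. by case: b => /= xy yz; [exact: le_trans yz|exact: le_trans xy]. Qed.

Lemma olt_le_trans b x y z : olt b x y -> ole b y z -> olt b x z.
Proof. by case: b => /= xy yz; [exact: lt_le_trans yz|exact: le_lt_trans xy]. Qed.

Lemma ole_lt_trans b x y z : ole b x y -> olt b y z -> olt b x z.
Proof. by case: b => /= xy yz; [exact: le_lt_trans yz|exact: lt_le_trans xy]. Qed.

Lemma olt_trans b x y z : olt b x y -> olt b y z -> olt b x z.
Proof. by move=> xy /oltW; exact: olt_le_trans. Qed.

Lemma oltNge b x y : olt b x y = ~~ ole b y x.
Proof. by case: b; rewrite /= ltNge. Qed.

Lemma olt_irr b x : olt b x x = false.
Proof. by case: b; rewrite /= ltxx. Qed.

Lemma olt_geF b x y : olt b x y -> ole b y x -> False.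
Proof. by rewrite oltNge => /negP. Qed.

Lemma oltP b x y : olt b x y \/ ole b y x.
Proof. by rewrite oltNge; case: ole; [right|left]. Qed.

Lemma ole_eqVlt b x y : ole b x y -> x = y \/ olt b x y.
Proof.
by case: b; rewrite /= le_eqVlt => /orP[/eqP->|]; [left|right|left|right].
Qed.

Lemma olt_total b x y : x <> y -> olt b x y \/ olt b y x.
Proof. by case: (oltP b x y) => [|/ole_eqVlt[->|]]; [left| |right]. Qed.

Lemma olt_neg b x y : olt (~~ b) x y = olt b y x.
Proof. by case: b. Qed.

Lemma ole_neg b x y : ole (~~ b) x y = ole b y x.
Proof. by case: b. Qed.

Lemma olt_dir x y : x <> y -> exists b, olt b x y.
Proof. by move/(olt_total true) => [|]; [exists true|exists false]. Qed.

Lemma convex_between (C : set X) b x y z : order_convex C ->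
  C x -> C y -> ole b x z -> ole b z y -> C z.
Proof. by case: b => /= cC Cx Cy xz zy; [exact: (cC x y)|exact: (cC y x)]. Qed.

Local Notation lopen := (@open (order_topology X)).

Lemma ray_lopen b x : lopen [set z | olt b x z].
Proof.
case: b; rewrite /olt /=.
  have -> : [set z | x < z]%O = `]x, +oo[%classic.
    by apply/seteqP; split => z /=; rewrite in_itv /= andbT.
  exact: (@rray_open _ (order_topology X)).
have -> : [set z | z < x]%O = `]-oo, x[%classic.
  by apply/seteqP; split => z /=; rewrite in_itv.
exact: (@lray_open _ (order_topology X)).
Qed.

Lemma oray_lopen b x : lopen [set z | olt b z x].
Proof.
have -> : [set z | olt b z x] = [set z | olt (~~ b) x z].
  by apply/seteqP; split => z /=; rewrite olt_neg.
exact: ray_lopen.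
Qed.

Lemma oconvexI (C C' : set X) :
  order_convex C -> order_convex C' -> order_convex (C `&` C').
Proof.
move=> cC cC' x y z [Cx Cx'] [Cy Cy'] xz zy.
by split; [exact: (cC x y)|exact: (cC' x y)].
Qed.

Lemma oray_convex b x : order_convex [set z | olt b z x].
Proof.
move=> y z w /=; case: b => /= yx zx yw wz; first exact: le_lt_trans zx.
exact: lt_le_trans yw.
Qed.

(** Closed-discreteness for the order topology, with a neighborhood whose only possible point of [A]
    is [x] itself; in this form it passes to finite unions by intersecting neighborhoods. *)
Definition isolating (A : set X) : Prop := forall x,
  exists J, [/\ lopen J, order_convex J, J x & J `&` A `<=` [set x]].

Lemma lnbhs_convex (U : set X) x : @nbhs _ (order_topology X) x U ->
  exists J, [/\ lopen J, order_convex J, J x & J `<=` U].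
Proof.
rewrite (@itv_nbhsE _ (order_topology X)) => -[i [oi xi] iU].
exists [set` i]; split => //.
  exact: (@itv_open_ends_open _ (order_topology X)).
move=> y z w /= yi zi yw wz.
case: i {oi xi iU} yi zi => l r; rewrite !itv_boundlr => /andP[ly _] /andP[_ zr].
by rewrite (le_trans ly) ?bnd_simp//= (le_trans _ zr) ?bnd_simp.
Qed.

Lemma closed_discrete_isolating (A : set X) :
  @closed_discrete (order_topology X) A -> isolating A.
Proof.
move=> cA x; have [U /lnbhs_convex[J [oJ cJ Jx JU]] UA] := cA x.
(* If [J] contains a point [a] of [A] other than [x], it contains no further one, and the open ray
   that ends at [a] cuts it off. *)
have [[a [[Ja Aa] ax]]|nA] := pselect (exists a, (J `&` A) a /\ a <> x).
  have [b xa] := olt_dir (nesym ax).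
  exists (J `&` [set z | olt b z a]); split => //.
  - by apply: openI => //; exact: oray_lopen.
  - by apply: oconvexI => //; exact: oray_convex.
  - move=> y [[Jy /= ya] Ay].
    have yE : y = a by apply: UA; split => //; exact: JU.
    by rewrite yE olt_irr in ya.
exists J; split => // y JAy; apply: contrapT => yx; apply: nA.
by exists y.
Qed.

Lemma isolatingU (A B : set X) :
  isolating A -> isolating B -> isolating (A `|` B).
Proof.
move=> hA hB x; have [J [oJ cJ Jx JA]] := hA x.
have [K [oK cK Kx KB]] := hB x; exists (J `&` K); split => //.
- exact: openI.
- exact: oconvexI.
- by move=> y [[Jy Ky] [Ay|By]]; [exact: JA|exact: KB].
Qed.

Lemma isolating_upto (A : nat -> set X) n : (forall i, isolating (A i)) ->
  isolating [set x | exists2 i, (i <= n)%N & A i x].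
Proof.
move=> hA; elim: n => [|n IH].
  rewrite (_ : [set x | _] = A 0%N) //; apply/seteqP; split => x /=.
    by move=> [i]; rewrite leqn0 => /eqP ->.
  by move=> Ax; exists 0%N.
rewrite (_ : [set x | _] =
  [set x | exists2 i, (i <= n)%N & A i x] `|` A n.+1); first exact: isolatingU.
apply/seteqP; split => x /=.
  move=> [i]; rewrite leq_eqVlt => /orP[/eqP->|]; first by right.
  by move=> ilt Ax; left; exists i.
by move=> [[i ilt Ax]|Ax]; [exists i => //; exact: leqW|exists n.+1].
Qed.

End Orientation.

(** * The two topologies of a GO-space *)

Section GOSpace.
Context d (X : orderType d) (tau : topology_on X) (hGO : GO_space tau).
Implicit Types (b : bool) (x y z : X) (A : set X).

Local Notation topen := (@open (space_of tau)).
Local Notation lopen := (@open (order_topology X)).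

Lemma convex_nbhd x (O : set X) : topen O -> O x ->
  exists C : set X, [/\ topen C, order_convex C, C x & C `<=` O].
Proof.
move=> oO Ox; have [_ [B [Bo Bx] Bc]] := hGO.
have /(Bx x) [C [BC Cx] CO] : @nbhs _ (space_of tau) x O.
  exact: open_nbhs_nbhs.
by exists C; split => //; [exact: Bo|exact: Bc].
Qed.

(** A convex neighborhood of [z] inside an open set separated from [x] cannot reach past [x], as it
    would then contain [x]. *)
Lemma oray_topen b x : topen [set z | olt b z x].
Proof.
apply: open_locally => z /= zx; have hH := hGO.1.
rewrite open_hausdorff in hH.
have zNx : z != x by apply/eqP => zE; rewrite zE olt_irr in zx.
have [[U V] [/= Uz Vx] [oU oV /eqP UV]] := hH _ _ zNx.
move: Uz Vx; rewrite !inE => Uz Vx.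
have [C [oC cC Cz CU]] := convex_nbhd oU Uz.
exists C; split => // w Cw /=; have [//|xw] := oltP b w x.
have Ux : U x by apply/CU/(convex_between cC Cz Cw (oltW zx) xw).
by have : (U `&` V) x by []; rewrite UV.
Qed.

Lemma ray_topen b x : topen [set z | olt b x z].
Proof.
have -> : [set z | olt b x z] = [set z | olt (~~ b) z x].
  by apply/seteqP; split => z /=; rewrite olt_neg.
exact: oray_topen.
Qed.

Lemma lopen_topen A : lopen A -> topen A.
Proof.
move=> oA; apply: open_locally => x Ax.
have : @nbhs _ (order_topology X) x A by exact: open_nbhs_nbhs.
rewrite (@itv_nbhsE _ (order_topology X)) => -[i [oi xi] iA].
exists [set` i]; split => // {xi iA}.
have lo (y : X) : topen `]y, +oo[%classic.
  rewrite (_ : `]y, +oo[%classic = [set z | olt true y z]); first exact: ray_topen.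
  by apply/seteqP; split => z /=; rewrite in_itv /= andbT.
have hi (y : X) : topen `]-oo, y[%classic.
  rewrite (_ : `]-oo, y[%classic = [set z | olt true z y]); first exact: oray_topen.
  by apply/seteqP; split => z /=; rewrite in_itv.
case: i oi; rewrite /itv_open_ends => [[[]t1|[]]] [[]t2|[]]// _.
- by rewrite set_itv_splitI /=; apply: openI; [exact: lo|exact: hi].
- by rewrite set_itvE; exact: openT.
Qed.

Lemma lambda_tau_closed_discrete A :
  @closed_discrete (order_topology X) A -> @closed_discrete (space_of tau) A.
Proof.
move=> cA x; have [U /lnbhs_convex[J [oJ _ Jx JU]] UA] := cA x.
exists J; first by apply: open_nbhs_nbhs; split => //; exact: lopen_topen.
by move=> y z [/JU Uy Ay] [/JU Uz Az]; exact: UA.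
Qed.

Lemma lambda_tau_sigma_closed_discrete A :
  sigma_closed_discrete (order_topology X) A ->
  sigma_closed_discrete (space_of tau) A.
Proof.
by move=> [F cF ->]; exists F => // n; exact: lambda_tau_closed_discrete.
Qed.

Definition go_side b : set X :=
  [set x | ~ topen [set x] /\ topen [set y | ole b x y]].

Lemma go_RL_sides : go_R tau `|` go_L tau = \bigcup_b go_side b.
Proof.
have RE : go_R tau = go_side true.
  have rE x : `[x, +oo[%classic = [set y | ole true x y].
    by apply/seteqP; split => z /=; rewrite in_itv /= andbT.
  by apply: eq_set => x; rewrite rE.
have LE : go_L tau = go_side false.
  have lE x : `]-oo, x]%classic = [set y | ole false x y].
    by apply/seteqP; split => z /=; rewrite in_itv.
  by apply: eq_set => x; rewrite lE.
rewrite RE LE; apply/seteqP; split => [x [Rx|Lx]|x [[] _]];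
  by [exists true|exists false|left|right].
Qed.

(** * One-sided points and the dense set *)

Section DenseSet.
Context (D : set X) (dD : @dense (order_topology X) D).

Lemma nonisolated_side b x (O : set X) : ~ topen [set z | ole b z x] ->
  topen O -> O x ->
  exists e, [/\ D e, olt b x e & forall w, ole b x w -> ole b w e -> O w].
Proof.
move=> niso oO Ox.
have next (C : set X) : topen C -> C x -> exists2 z, C z & olt b x z.
  move=> oC Cx; apply: contrapT => hC; apply: niso; apply: open_locally => z /= zx.
  have [->|{}zx] := ole_eqVlt zx.
    exists C; split => // w Cw /=; have [xw|//] := oltP b x w.
    by case: hC; exists w.
  by exists [set w | olt b w x]; split => //; [exact: oray_topen|move=> w; exact: oltW].
have [C [oC cC Cx CO]] := convex_nbhd oO Ox.
have [z Cz xz] := next C oC Cx.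
(* The second point [z'] makes the open interval between [x] and [z] nonempty, so that it meets
   [D]. *)
have [z' [_ /= z'z] xz'] : exists2 z', (C `&` [set w | olt b w z]) z' & olt b x z'.
  by apply: next => //; apply: openI => //; exact: oray_topen.
have [e [[xe ez] De]] : [set w | olt b x w] `&` [set w | olt b w z] `&` D !=set0.
  apply: dD; first by exists z'.
  by apply: openI; [exact: ray_lopen|exact: oray_lopen].
exists e; split => // w xw we; apply: CO.
by apply: (convex_between cC Cx Cz xw); exact: oltW (ole_lt_trans we ez).
Qed.

Lemma go_side_nonisolated b x (O : set X) : go_side b x -> topen O -> O x ->
  exists e, [/\ D e, olt b x e & forall w, ole b x w -> ole b w e -> O w].
Proof.
move=> [nI oR]; apply: nonisolated_side => oL; apply: nI.
have -> : [set x] = [set y | ole b x y] `&` [set y | ole b y x].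
  apply/seteqP; split => y /=; first by move=> ->; split; exact: ole_refl.
  by move=> [xy] /ole_eqVlt [//|/olt_geF /(_ xy)].
exact: openI.
Qed.

Context (Dn : nat -> set X) (isoD : forall n, isolating (Dn n))
  (DE : D = \bigcup_n Dn n).

(** The points of [A] are sorted by an [n] for which [Dn n] meets the gap after them. Two points of
    one class have a point of [Dn n] between them, so a neighborhood of [x] isolating for [Dn n]
    holds at most one of them on each side of [x]. *)
Lemma one_sided_gap_sigma_closed_discrete b A :
  (forall a, A a -> exists e,
     [/\ D e, olt b a e & forall z, olt b a z -> ole b z e -> ~ A z]) ->
  sigma_closed_discrete (order_topology X) A.
Proof.
move=> gap; exists (fun n => [set a | A a /\ exists e,
    [/\ Dn n e, olt b a e & forall z, olt b a z -> ole b z e -> ~ A z]]).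
  move=> n x; have [J [oJ cJ Jx JD]] := isoD n x; set An := [set a | _].
  (* The point of [Dn n] following [a] lies before [a'], and in [J]: it is [x]. *)
  have sep a a' : (J `&` An) a -> (J `&` An) a' -> olt b a a' ->
      olt b a x /\ olt b x a'.
    move=> [Ja [_ [e [De ae gapa]]]] [Ja' [Aa' _]] aa'.
    have ea' : olt b e a' by case: (oltP b e a') => // /(gapa _ aa').
    suff <- : e = x by [].
    by apply: JD; split => //; exact: (convex_between cJ Ja Ja' (oltW ae) (oltW ea')).
  have subs (K : set X) : K `<=` J -> (forall p, (K `&` An) p -> ole b x p) ->
      is_subset1 (K `&` An).
    move=> KJ Kx p q Kp Kq; apply: contrapT => /(olt_total b)[pq|qp].
      have [px _] := sep p q (conj (KJ _ Kp.1) Kp.2) (conj (KJ _ Kq.1) Kq.2) pq.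
      exact: olt_geF px (Kx _ Kp).
    have [qx _] := sep q p (conj (KJ _ Kq.1) Kq.2) (conj (KJ _ Kp.1) Kp.2) qp.
    exact: olt_geF qx (Kx _ Kq).
  (* A point [p] of the class before [x] is removed by cutting [J] at [p]; what is left of the class
     is not before [x]. *)
  have [[p JAp px]|nop] := pselect (exists2 p, (J `&` An) p & olt b p x).
    exists (J `&` [set z | olt b p z]).
      by apply: open_nbhs_nbhs; split => //; apply: openI => //; exact: ray_lopen.
    apply: subs => [z []//|q [[Jq /= pq] Aq]].
    by have [_ /oltW] := sep p q JAp (conj Jq Aq) pq.
  exists J; first exact: open_nbhs_nbhs.
  apply: subs => // p JAp; have [px|//] := oltP b p x.
  by case: nop; exists p.
apply/seteqP; split => [a Aa|a [n _ []]//].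
have [e [De ae g]] := gap a Aa; move: De; rewrite DE => -[n _ Dne].
by exists n => //; split => //; exists e.
Qed.

Lemma tau_discrete_side_sigma_closed_discrete b A : A `<=` go_side b ->
  @closed_discrete (space_of tau) A ->
  sigma_closed_discrete (order_topology X) A.
Proof.
move=> AR cA; apply: (@one_sided_gap_sigma_closed_discrete b) => a Aa.
have [U] := cA a; rewrite nbhsE => -[V [oV Va] VU] UA.
have [e [De ae eV]] := go_side_nonisolated (AR _ Aa) oV Va.
exists e; split => // z az ze Az.
have za : z = a by apply: UA; split => //; apply/VU => //; exact: eV (oltW az) ze.
by rewrite za olt_irr in az.
Qed.

Lemma tau_lambda_sigma_closed_discrete_side A : A `<=` \bigcup_b go_side b ->
  sigma_closed_discrete (space_of tau) A ->
  sigma_closed_discrete (order_topology X) A.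
Proof.
move=> AS [F cF FE].
have -> : A = \bigcup_b \bigcup_n (F n `&` go_side b).
  apply/seteqP; split => [x Ax|x [b _ [n _ [Fx _]]]]; last by rewrite FE; exists n.
  have [b _ Sx] := AS _ Ax; move: Ax; rewrite FE => -[n _ Fx].
  by exists b => //; exists n.
apply: sigma_closed_discrete_bigcup => b.
apply: sigma_closed_discrete_bigcup => n.
apply: (@tau_discrete_side_sigma_closed_discrete b); first by move=> x [].
by apply: sub_closed_discrete (cF n) => x [].
Qed.

Lemma no_descending_stars b (S : set X) :
  monotonically_countably_metacompact (space_of tau) ->
  (forall x, S x -> topen [set y | ole b x y]) ->
  exists2 G : X -> set X,
    (forall x, S x -> topen (G x) /\ G x x) &
    forall y : nat -> X, (forall i, S (y i)) ->
      (forall i, olt b (y i.+1) (y i)) -> exists i, ~ G (y i.+1) (y 0%N).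
Proof.
move=> [r [rc rmono]] oS.
pose cov x : set (set X) := [set [set y | olt b y x]; [set y | ole b x y]].
have cov_ok x : S x -> @open_cover (space_of tau) (cov x) /\ countable (cov x).
  move=> Sx; split; last by apply: finite_set_countable; exact: finite_set2.
  split.
    by move=> _ [->|->]; [exact: oray_topen|exact: oS].
  apply/seteqP; split => // y _; have [yx|xy] := oltP b y x.
    by exists [set y | olt b y x] => //; left.
  by exists [set y | ole b x y] => //; right.
have /choice [G GP] : forall x, exists G : set X, S x -> r (cov x) G /\ G x.
  move=> x; have [Sx|] := pselect (S x); last by exists set0.
  have [[_ cr] _ _] := rc _ (cov_ok x Sx).
  have [G rG Gx] : cover (r (cov x)) id x by rewrite cr.
  by exists G.
exists G.
  move=> x Sx; have [rG Gx] := GP x Sx; split => //.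
  by have [[+ _] _ _] := rc _ (cov_ok x Sx); exact.
move=> y Sy ydec; apply: contrapT => nG.
have {nG}Gy i : G (y i.+1) (y 0%N).
  by apply: contrapT => nGi; apply: nG; exists i.
have ylt i j : (i < j)%N -> olt b (y j) (y i).
  elim: j => // j IH; rewrite ltnS leq_eqVlt => /orP[/eqP->//|/IH].
  exact: olt_trans.
have yle i : ole b (y i) (y 0%N).
  by case: i => [|i]; [exact: ole_refl|apply: oltW; exact: ylt].
pose W : set (set X) := \bigcup_i cov (y i).
have W_ok : @open_cover (space_of tau) W /\ countable W.
  split; last first.
    apply: bigcup_countable => // i _.
    by have [] := cov_ok _ (Sy i).
  split; first by move=> A [i _]; have [[+ _] _] := cov_ok _ (Sy i); exact.
  apply/seteqP; split => // z _.
  have [[_ cE] _] := cov_ok _ (Sy 0%N).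
  have [A cA Az] : cover (cov (y 0%N)) id z by rewrite cE.
  by exists A => //; exists 0%N.
have [_ rfin rref] := rc _ W_ok.
have /choice [H HP] : forall i, exists H : set X, r W H /\ G (y i.+1) `<=` H.
  move=> i; have covW : refines (cov (y i.+1)) W by move=> A ?; exists A => //; exists i.+1.
  have [rG _] := GP _ (Sy i.+1).
  by have [H rH GH] := rmono _ _ (cov_ok _ (Sy _)) W_ok covW _ rG; exists H.
(* A member of [r W] through [y 0] cannot lie in an open ray that ends at some [y i], so it lies in
   a closed ray that starts at one. The index 0 is a default for all other sets. *)
have /choice [ix ixP] : forall A : set X, exists i, r W A -> A (y 0%N) ->
    A `<=` [set z | ole b (y i) z].
  move=> A; have [rA|nrA] := pselect (r W A); last by exists 0%N.
  have [Ay|nAy] := pselect (A (y 0%N)); last by exists 0%N.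
  have [B [i _ [->|->]] AB] := rref _ rA; last by exists i.
  by case: (olt_geF (AB _ Ay) (yle i)).
have /finite_seqP [s sE] := rfin (y 0%N).
(* [H N] is among the members through [y 0], so its ray starts at a [y i] with [i <= N]; yet it
   contains [y N.+1], which comes strictly before [y i]. *)
pose N := (\max_(A <- s) ix A)%N.
have [rH GH] := HP N.
have Hy0 : H N (y 0%N) by apply: GH; exact: Gy.
have Hs : H N \in s by have : [set` s] (H N) by rewrite -sE.
have ixN : (ix (H N) <= N)%N by apply: (@leq_bigmax_seq _ s xpredT ix).
have := ixP _ rH Hy0 _ (GH _ (GP _ (Sy N.+1)).2).
by apply: olt_geF; exact: ylt.
Qed.

Lemma go_side_sigma_closed_discrete b :
  monotonically_countably_metacompact (space_of tau) ->
  sigma_closed_discrete (order_topology X) (go_side b).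
Proof.
move=> hM.
have [G oG nodesc] := no_descending_stars hM (fun x (Sx : go_side b x) => Sx.2).
pose S n := [set x | go_side b x /\ exists e,
  [/\ Dn n e, olt b x e & forall w, ole b x w -> ole b w e -> G x w]].
have -> : go_side b = \bigcup_n S n.
  apply/seteqP; split => [x Sx|x [n _ []]//].
  have [oGx Gx] := oG _ Sx.
  have [e [+ xe eG]] := go_side_nonisolated Sx oGx Gx; rewrite DE => -[n _ De].
  by exists n => //; split => //; exists e.
apply: sigma_closed_discrete_bigcup => n.
apply: (@one_sided_gap_sigma_closed_discrete b) => x [Sx _].
have [J [oJ cJ Jx JD]] := isoD n x.
have [e [De xe eJ]] := go_side_nonisolated Sx (lopen_topen oJ) Jx.
apply: contrapT => nogap.
(* Without a gap after [x], points of [S n] come arbitrarily close to [x] on that side, which yields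
   a forbidden sequence starting inside [J]. *)
have below f : D f -> olt b x f -> exists z, [/\ S n z, olt b x z & ole b z f].
  move=> Df xf; apply: contrapT => nz; apply: nogap; exists f; split => // z xz zf Sz.
  by apply: nz; exists z.
have [y0 [Sy0 xy0 y0e]] := below e De xe.
pose T := {z : X | S n z /\ olt b x z}.
have [y [y0E yP]] : {y : nat -> T | y 0%N = exist _ y0 (conj Sy0 xy0) /\
    forall i, olt b (sval (y i.+1)) (sval (y i))}.
  apply: (@dependent_choice T (fun u v => olt b (sval v) (sval u))) =>
    -[z [Sz xz]] /=; apply: cid.
  have [f [Df xf fz]] := go_side_nonisolated Sx (oray_topen b z) xz.
  have [z' [Sz' xz' z'f]] := below f Df xf.
  by exists (exist _ z' (conj Sz' xz')) => /=; exact: fz (oltW xz') z'f.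
have [i] := nodesc (fun i => sval (y i)) (fun i => (svalP (y i)).1.1) yP.
rewrite y0E /=; case; have [[_ [f [Df yf yG]]] xy] := svalP (y i.+1).
have y0i : ole b (sval (y i.+1)) y0.
  rewrite -[y0]/(sval (exist (fun z => S n z /\ olt b x z) y0 (conj Sy0 xy0))) -y0E.
  elim: i {f Df yf yG xy} => [|i IH]; first exact: oltW.
  by apply: ole_trans IH; exact: oltW.
(* The point [f] of [Dn n] reached by the star of [y i.+1] lies beyond [y0], and so the star
   contains [y0]: otherwise [f] would be a point of [J] other than [x]. *)
apply: yG => //; have [/oltW//|fy0] := oltP b y0 f.
have xf := olt_trans xy yf.
have fx : f = x.
  by apply: JD; split => //; apply: eJ; [exact: oltW|exact: ole_trans fy0 y0e].
by rewrite fx olt_irr in xf.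
Qed.

End DenseSet.

(** * Cells and the monotone operator *)

Section Cells.
Context (D : set X) (dD : @dense (order_topology X) D).
Context (E : nat -> set X) (isoE : forall n, isolating (E n)).
Context (Emono : forall m n, (m <= n)%N -> E m `<=` E n).
Context (ED : D `<=` \bigcup_n E n).
Context (ES : \bigcup_b go_side b `<=` \bigcup_n E n).

(* The points reachable from [x] without meeting another point of [E n]; a
   point of [E n] does not reach beyond a side on which it is isolated. *)
Definition cell n x : set X := [set y |
  (forall b e, E n e -> olt b x e -> ~ ole b e y) /\
  (E n x -> forall b, olt b x y -> ~ topen [set z | ole b z x])].

Lemma cell_refl n x : cell n x x.
Proof.
split=> [b e _ xe /(olt_geF xe)//|_ b]; by rewrite olt_irr.
Qed.

Lemma cell_center n x y : cell n x y -> E n y -> x = y.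
Proof.
move=> [xy _] Ey; apply: contrapT => /olt_dir[b]xb.
exact: xy Ey xb (ole_refl _ _).
Qed.

Lemma cell_antimono m n x : (m <= n)%N -> cell n x `<=` cell m x.
Proof.
move=> mn y [gap side]; split=> [b e /(Emono mn)|/(Emono mn)]; [exact: gap|exact: side].
Qed.

Lemma sub_cell n x y : ~ E n y -> cell n x y -> cell n y `<=` cell n x.
Proof.
move=> nEy; have [->|/nesym xNy] := pselect (y = x); first by move=> _ z.
move=> [gap side] w [ygap _]; split => [b e Ee xe ew|Ex b xw].
  have [ye|ey] := oltP b y e; first exact: (ygap b e).
  exact: (gap b e).
(* [w] is on the same side of [x] as [y], since otherwise the point [x] of [E n] would block the way
   from [y] to [w]. *)
have [c xy] := olt_dir xNy; suff -> : b = c by exact: side.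
apply: contrapT => bc; have bE : b = ~~ c by case: (b) (c) bc => [] [].
have yx : olt b y x by rewrite bE olt_neg.
exact: (ygap b x Ex yx (oltW xw)).
Qed.

Lemma sub_cell_off n x y : ~ E n x -> ~ E n y -> cell n x y ->
  cell n x `<=` cell n y.
Proof.
move=> nEx nEy [gap side]; apply: sub_cell => //; split=> // b e Ee ye ex.
apply: (gap (~~ b) e Ee); last by rewrite ole_neg; exact: oltW.
by rewrite olt_neg; have [xE|//] := ole_eqVlt ex; rewrite -xE in nEx.
Qed.

Lemma cell_open n x : topen (cell n x).
Proof.
apply: open_locally => y xy.
have [J [/lopen_topen oJ cJ Jy JE]] := isoE n y.
have [xE|xNy] := pselect (x = y).
  (* [K b] is the closed ray up to [x] if that ray is open, and the whole space otherwise; it is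
     open in both cases. *)
  subst y; pose K b := [set z | topen [set w | ole b w x] -> ole b z x].
  have oK b : topen (K b).
    have [iso|niso] := pselect (topen [set w | ole b w x]).
      rewrite (_ : K b = [set w | ole b w x]) //.
      by apply/seteqP; split => z /= Kz; [exact: (Kz iso)|move=> _].
    by rewrite (_ : K b = setT); [exact: openT|apply/seteqP; split => // z _ /niso].
  have Kx b : K b x by move=> _; exact: ole_refl.
  exists (J `&` (K true `&` K false)); split => //.
    by apply: openI => //; exact: openI.
  move=> z [Jz [Kt Kf]]; split=> [b e Ee xe ez|_ b xz oz].
    have eE : e = x.
      by apply: JE; split => //; exact: convex_between cJ Jy Jz (oltW xe) ez.
    by rewrite eE olt_irr in xe.
  have Kz : K b z by case: (b).
  exact: olt_geF xz (Kz oz).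
have nEy : ~ E n y by move/(cell_center xy).
exists J; split => // z Jz; apply: (sub_cell nEy xy); split => // b e Ee ye ez.
have eE : e = y.
  by apply: JE; split => //; exact: convex_between cJ Jy Jz (oltW ye) ez.
by rewrite eE olt_irr in ye.
Qed.

Definition cells n : set (set X) := range (cell n).

(** Of two centers on the same side of [y], the nearer blocks the farther. *)
Lemma center_unique n b e e' y : E n e -> E n e' -> olt b e y -> olt b e' y ->
  cell n e y -> cell n e' y -> e = e'.
Proof.
move=> Ee Ee' ey e'y [gap _] [gap' _]; apply: contrapT => /(olt_total b)[ee|ee].
  exact: (gap b e' Ee' ee (oltW e'y)).
exact: (gap' b e Ee ee (oltW ey)).
Qed.

(** At most three cells of a level contain [y]: its own, which equals that of any point off [E n]
    reaching [y], and one centered in [E n] on each side. *)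
Lemma cells_point_finite n : point_finite (cells n).
Proof.
move=> y; pose C b : set (set X) :=
  [set A | exists e, [/\ E n e, olt b e y, cell n e y & A = cell n e]].
have finC b : finite_set (C b).
  have [[e [Ee ey ye]]|nC] := pselect (exists e, [/\ E n e, olt b e y & cell n e y]).
    apply: (@sub_finite_set _ _ [set cell n e]); last exact: finite_set1.
    by move=> _ [e' [Ee' e'y ye' ->]]; rewrite (center_unique Ee Ee' ey e'y).
  rewrite (_ : C b = set0) //; apply/seteqP; split => // A [e [? ? ? _]].
  by apply: nC; exists e.
apply: (@sub_finite_set _ _ ([set cell n y] `|` (C true `|` C false))).
  move=> _ [[x _ <-] xy]; have [->|xNy] := pselect (x = y); first by left.
  have nEy : ~ E n y by move/(cell_center xy).
  have [Ex|nEx] := pselect (E n x).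
    by right; have [[] yx] := olt_dir xNy; [left|right]; exists x.
  left; apply/seteqP; split; [exact: sub_cell_off|exact: sub_cell].
rewrite !finite_setU; split; first exact: finite_set1.
by split; exact: finC.
Qed.

(** For [y] off [E n], only cells centered in [E n] can contain [y] without lying in the cell of
    [y]. There is at most one such center on each side, and a point of [D] between it and [y] blocks
    it at a later level. *)
Lemma cell_star_sub n x y : cell n x y ->
  exists k, forall w, cell k w y -> cell k w `<=` cell n x.
Proof.
move=> xy; have [Ey|nEy] := pselect (E n y).
  by exists n => w wy; rewrite (cell_center wy Ey) (cell_center xy Ey).
have avoid b : exists2 k, (n <= k)%N &
    forall e, E n e -> olt b e y -> ~ cell k e y.
  have [[e [Ee ey ye]]|nC] := pselect (exists e, [/\ E n e, olt b e y & cell n e y]).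
    have [f [Df ef fy]] := nonisolated_side dD (ye.2 Ee _ ey) (oray_topen b y) ey.
    have [k _ Ekf] := ED Df; exists (maxn n k); first exact: leq_maxl.
    move=> e' Ee' e'y ye'.
    have e'E : e' = e.
      by apply: (center_unique Ee' Ee e'y ey) => //; exact: cell_antimono (leq_maxl _ _) _ ye'.
    subst e'; apply: (ye'.1 b f) => //; first exact: Emono (leq_maxr _ _) _ Ekf.
    by apply/oltW/fy => //; [exact: oltW|exact: ole_refl].
  exists n => // e Ee ey ye; apply: nC; by exists e.
have [k0 nk0 h0] := avoid true; have [k1 nk1 h1] := avoid false.
pose k := maxn k0 k1; have nk : (n <= k)%N by rewrite leq_max nk0.
exists k => w wy; have wny : cell n w y by exact: cell_antimono nk _ wy.
apply: subset_trans (cell_antimono nk) _.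
apply: subset_trans (sub_cell nEy xy); apply: sub_cell_off => // Ew.
have wNy : w <> y by move=> wE; rewrite wE in Ew.
have [[] wly] := olt_dir wNy.
  by apply: (h0 w) => //; exact: cell_antimono (leq_maxl _ _) _ wy.
by apply: (h1 w) => //; exact: cell_antimono (leq_maxr _ _) _ wy.
Qed.

Lemma cell_star_nonisolated y (O : set X) : ~ topen [set y] -> topen O -> O y ->
  exists k, forall w, cell k w y -> cell k w `<=` O.
Proof.
move=> nI oO Oy.
(* On a side where [y] is isolated, [y] itself becomes a center whose cell avoids that side. On
   another side two barriers within [O] are needed: [e'] stops the cells from points before it, and
   [e] keeps those from [e'] or beyond away from [y]. *)
pose shields b k := (topen [set z | ole b z y] -> E k y) /\
  (~ topen [set z | ole b z y] -> exists e e', [/\ E k e, E k e', olt b y e,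
     olt b e e' & forall w, ole b y w -> ole b w e' -> O w]).
have side b : exists k, shields b k.
  have [iso|niso] := pselect (topen [set z | ole b z y]).
    have [k _ Ey] : (\bigcup_n E n) y.
      apply: ES; exists (~~ b) => //; split => //.
      rewrite (_ : [set z | _] = [set z | ole b z y]) //.
      by apply/seteqP; split => z /=; rewrite ole_neg.
    by exists k; split => // /(_ iso).
  have [e' [/ED[k' _ Ee'] ye' e'O]] := nonisolated_side dD niso oO Oy.
  have [e [/ED[k _ Ee] ye ee']] := nonisolated_side dD niso (oray_topen b e') ye'.
  exists (maxn k k'); split => // _; exists e, e'; split => //.
  - exact: Emono (leq_maxl _ _) _ Ee.
  - exact: Emono (leq_maxr _ _) _ Ee'.
  - by apply: ee'; [exact: oltW|exact: ole_refl].
have [k0 h0] := side true; have [k1 h1] := side false.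
pose k := maxn k0 k1.
have mono b m : (m <= k)%N -> shields b m -> shields b k.
  move=> mk [h h']; split=> [/h|/h' [e [e' [Ee Ee' ye ee' eO]]]].
    exact: Emono.
  by exists e, e'; split => //; exact: (Emono mk).
have {h0 h1 side mono}side b : shields b k.
  case: b; first exact: mono (leq_maxl _ _) h0.
  exact: mono (leq_maxr _ _) h1.
exists k => x xy z xz; have [->//|/nesym yNz] := pselect (z = y).
have [b yz] := olt_dir yNz; have [iso niso] := side b.
have [e [e' [Ee Ee' ye ee' eO]]] : exists e e', [/\ E k e, E k e', olt b y e,
       olt b e e' & forall w, ole b y w -> ole b w e' -> O w].
  apply: niso => oy; have Ey := iso oy.
  move: xz; rewrite (cell_center xy Ey) => -[_ /(_ Ey b yz)]; exact.
apply: eO; first exact: oltW.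
have [e'z|] := oltP b e' z => //.
have [xe'|e'x] := oltP b x e'.
  by case: (xz.1 b e' Ee' xe' (oltW e'z)).
case: (xy.1 (~~ b) e Ee).
  by rewrite olt_neg; exact: olt_le_trans e'x.
by rewrite ole_neg; exact: oltW.
Qed.

Lemma cells_monotonically_metacompact :
  monotonically_metacompact (space_of tau).
Proof.
pose P (U : set (set X)) n A := cells n A /\ exists2 V, U V & A `<=` V.
pose big U := [set A | exists2 n, P U n A &
  forall m B, P U m B -> A `<=` B -> (n <= m)%N].
pose small U := [set [set x] | x in [set x | forall n A, P U n A -> ~ A x]].
have to_big U n A : P U n A -> exists2 B, big U B & A `<=` B.
  move=> PA.
  have ex : exists m, `[< exists2 B, P U m B & A `<=` B >].
    by exists n; apply/asboolP; exists A.
  case: (ex_minnP ex) => m /asboolP[B PB AB] mmin.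
  exists B => //; exists m => // m' B' PB' BB'.
  by apply: mmin; apply/asboolP; exists B' => //; exact: subset_trans BB'.
have covers (U : set (set X)) x : exists2 A, (big U `|` small U) A & A x.
  have [[n [A [PA Ax]]]|nP] := pselect (exists n A, P U n A /\ A x).
    by have [B bB AB] := to_big _ _ _ PA; exists B; [left|exact: AB].
  exists [set x] => //; right; exists x => // n A PA Ax.
  by apply: nP; exists n, A.
exists (fun U => big U `|` small U); split.
  move=> U [oU cU]; split.
  - split; last by apply/seteqP; split => // x _; have [A ? ?] := covers U x; exists A.
    move=> _ [[n [[x _ <-] _] _]|[x nx <-]]; first exact: cell_open.
    (* If [x] were not isolated, its cell at some level would fit into [V], so [x] would not be a
       leftover point. *)
    apply: contrapT => nI; have [V UV Vx] : cover U id x by rewrite cU.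
    have [k kV] := cell_star_nonisolated nI (oU _ UV) Vx.
    apply: (nx k (cell k x)); last exact: cell_refl.
    by split; [exists x|exists V => //; apply: kV; exact: cell_refl].
  - move=> y; have [[n [A [[[x _ <-] [V UV xV]] xy]]]|nP] :=
      pselect (exists n A, P U n A /\ A y).
      have [k kx] := cell_star_sub xy.
      apply: (@sub_finite_set _ _ (\bigcup_(m in `I_k.+1) [set A | cells m A /\ A y])).
        move=> B [[[m [[w _ <-] _] mmin]|[z nz <-]] By].
          exists m; last by split => //; exists w.
          rewrite /= ltnS leqNgt; apply/negP => km.
          (* The cell of [w] at level [k] contains the kept one and still fits into [V], against the
             minimality of [m]. *)
          have wk := cell_antimono (x := w) (ltnW km).
          suff : (m <= k)%N by rewrite leqNgt km.
          apply: (mmin k (cell k w)) => //; split; first by exists w.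
          by exists V => //; apply: subset_trans xV; apply: kx; exact: wk.
        rewrite /= in By; subst z; case: (nz n (cell n x)) => //.
        by split; [exists x|exists V].
      by apply: bigcup_finite => [|m _]; [exact: finite_II|exact: cells_point_finite].
    apply: (@sub_finite_set _ _ [set [set y]]); last exact: finite_set1.
    move=> B [[[m PB _]|[z _ <-]] By].
      by case: nP; exists m, B.
    by rewrite /= in By; subst z.
  - move=> A [[n [_ ?] _]//|[x _ <-]].
    have [V UV Vx] : cover U id x by rewrite cU.
    by exists V => // _ ->.
move=> U V _ _ UV A [[n [cA [B UB AB]] _]|[x _ <-]].
  have [C VC BC] := UV _ UB.
  have [A' bA' AA'] : exists2 B', big V B' & A `<=` B'.
    by apply: (to_big _ n); split => //; exists C => //; exact: subset_trans BC.
  by exists A' => //; left.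
have [B rB Bx] := covers V x.
by exists B => // _ ->.
Qed.

End Cells.

End GOSpace.

Theorem theorem1p4 (d : Order.disp_t) (X : orderType d) (tau : topology_on X)
  (hGO : GO_space tau)
  (hD : exists2 D : set (order_topology X),
      dense D & sigma_closed_discrete (order_topology X) D) :
  [<-> monotonically_metacompact (space_of tau);
       monotonically_countably_metacompact (space_of tau);
       sigma_closed_discrete (space_of tau) (go_R tau `|` go_L tau);
       sigma_closed_discrete (order_topology X) (go_R tau `|` go_L tau)].
Proof.
have [D dD [Dn cDn DE]] := hD.
have isoD n : isolating (Dn n) by exact: closed_discrete_isolating.
rewrite go_RL_sides; tfae.
- move=> [r [rc rmono]]; exists r; split.
    by move=> U [oU _]; exact: rc.
  by move=> U V [oU _] [oV _]; exact: rmono.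
- move=> hM; apply: (lambda_tau_sigma_closed_discrete hGO).
  apply: sigma_closed_discrete_bigcup => b.
  exact: (go_side_sigma_closed_discrete hGO dD isoD DE).
- exact: (tau_lambda_sigma_closed_discrete_side hGO dD isoD DE).
(* Joining the two sequences and taking finite unions gives increasing levels that exhaust both [D]
   and the one-sided points. *)
- move=> [F cF FE]; pose A n := Dn n `|` F n.
  have isoA n : isolating (A n).
    by apply: isolatingU => //; exact: closed_discrete_isolating.
  apply: (@cells_monotonically_metacompact _ _ _ hGO D dD
    (fun n => [set x | exists2 i, (i <= n)%N & A i x])).
  + by move=> n; exact: isolating_upto.
  + by move=> m n mn x [i im Ax]; exists i => //; exact: leq_trans mn.
  + by rewrite DE => x [n _ Dx]; exists n => //; exists n => //; left.
  + by rewrite FE => x [n _ Fx]; exists n => //; exists n => //; right.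
Qed.
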